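(* Let $P,Q,D\in\mathbb{C}[X]$ with $\deg(D)=2$ and $\deg(P)=d$. The following conditions are equivalent: (1) We have the identity $P^2-DQ^2=1$. (2) There exist constants $\lambda,\mu\in\mathbb{C}^\times$ and $\nu\in\mathbb{C}$ such that \[P=\pm T_d(\lambda X+\nu),\qquad Q=\mu\, U_{d-1}(\lambda X+\nu),\qquad D=\mu^{-2}\left((\lambda X+\nu)^2-1\right).\]
   Context: For any non-negative integer $n$, $T_n, U_n\in\mathbb{Z}[X]$ are the Chebyshev polynomials of the first and second kind of degree $n$: both sequences satisfy $u_{n+1}=2Xu_n-u_{n-1}$, with $T_0=1$, $T_1=X$ and $U_0=1$, $U_1=2X$. *)

(* Defs.v *)
From HB Require Import structures.
From mathcomp Require Export all_boot all_order all_algebra.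
From mathcomp Require Export reals complex.

Set Implicit Arguments.
Unset Strict Implicit.
Unset Printing Implicit Defensive.

Import GRing.Theory.
Local Open Scope ring_scope.

Fixpoint chebyshevT (n : nat) : {poly int} :=
  if n is n1.+1 then
    if n1 is n2.+1 then 2 *: 'X * chebyshevT n1 - chebyshevT n2 else 'X
  else 1.

Fixpoint chebyshevU (n : nat) : {poly int} :=
  if n is n1.+1 then
    if n1 is n2.+1 then 2 *: 'X * chebyshevU n1 - chebyshevU n2 else 2 *: 'X
  else 1.

(* The image in K[X] of an integer polynomial, evaluated at a X + b. *)
Definition comp_affine (K : nzRingType) (p : {poly int}) (a b : K) : {poly K} :=
  map_poly intr p \Po (a *: 'X + b%:P).

(* Main.v *)
Require Import Defs.
From mathcomp Require Import ring zify.

Set Implicit Arguments.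
Unset Strict Implicit.
Unset Printing Implicit Defensive.

Import GRing.Theory Num.Theory.
Local Open Scope ring_scope.

(** The equation says that [P + Q * sqrt D] has norm 1, so the theorem
    describes the units of norm 1 in the ring K[X][sqrt D].

    If D is a square W ^+ 2, the equation factors as
    [(P - W * Q) * (P + W * Q) = 1]; both factors are constant, hence so is P
    ([pell_square_const]), which [0 < d] excludes. Otherwise D has two distinct
    roots, and completing the square over an algebraically closed field gives
    [D = mu ^- 2 *: (Y ^+ 2 - 1)] for some Y of degree 1
    ([quadratic_square_or_affine]). Absorbing mu in Q leaves the equation
    [P ^+ 2 - (Y ^+ 2 - 1) * Q ^+ 2 = 1].

    Here Y + sqrt (Y ^+ 2 - 1) is a unit of norm 1, whose n-th power is
    T_n(Y) + U_(n-1)(Y) * sqrt (Y ^+ 2 - 1) ([chebTS], [chebUpredS]); so these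
    pairs are solutions ([cheb_pell]). Conversely, given a solution with
    Q != 0, one of P + Y * Q and P - Y * Q has full degree; after changing the
    sign of Q if needed, it is the first one. Dividing the unit by
    Y + sqrt (Y ^+ 2 - 1) gives the solution
    [(Y * P - (Y ^+ 2 - 1) * Q, Y * Q - P)], whose first component has smaller
    degree than P ([pell_descent]). The descent ends at Q = 0 and P = 1 or
    P = -1, so every unit of norm 1 is, up to sign and conjugation, a power of
    the fundamental one ([pell_cheb]). Comparing degrees, the exponent is d
    ([size_chebT]). *)

(** * Chebyshev polynomials as powers of a unit *)

(** U_(n-1), with U_(-1) = 0: with this shift of index, T_n and U_(n-1) are the
    two coordinates of the same power, for n = 0 as well. *)
Definition chebyshevUpred (n : nat) : {poly int} :=
  if n is m.+1 then chebyshevU m else 0.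

Lemma chebyshevSS n :
  chebyshevT n.+2 = 2 * 'X * chebyshevT n.+1 - chebyshevT n /\
  chebyshevUpred n.+2 = 2 * 'X * chebyshevUpred n.+1 - chebyshevUpred n.
Proof.
have E : 2 *: 'X = 2 * 'X :> {poly int} by rewrite -mul_polyC polyCMn.
by case: n => [|n] /=; rewrite E ?mulr1 ?subr0.
Qed.

(** Multiplication of T_n + U_(n-1) * sqrt (X^2 - 1) by X + sqrt (X^2 - 1),
    in coordinates. *)
Lemma chebyshevS n :
  chebyshevT n.+1 = 'X * chebyshevT n + ('X ^+ 2 - 1) * chebyshevUpred n /\
  chebyshevUpred n.+1 = chebyshevT n + 'X * chebyshevUpred n.
Proof.
elim: n => [|n [IHT IHU]]; first by split=> /=; ring.
have [-> ->] := chebyshevSS n; rewrite IHT IHU.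
by split; ring.
Qed.

(** * Polynomials over a field *)

(** The instance of [size_mul] in which the sizes are elaborated through the
    field structure of K, so that all occurrences of the size of a given
    polynomial are syntactically equal, as [lia] requires. *)
Lemma size_mulf (K : fieldType) (A B : {poly K}) :
  A != 0 -> B != 0 -> size (A * B) = (size A + size B).-1.
Proof. exact: size_mul. Qed.

Lemma size_addf_leq (K : fieldType) (A B : {poly K}) (k : nat) :
  (size A <= k)%N -> (size B <= k)%N -> (size (A + B)%R <= k)%N.
Proof.
by move=> sA sB; rewrite (leq_trans (size_polyD _ _)) // geq_max sA.
Qed.

Lemma sqr_eq1_sign (K : fieldType) (P : {poly K}) :
  P ^+ 2 = 1 -> exists e : bool, P = (-1) ^+ e.
Proof.
move/eqP; rewrite sqrf_eq1 => /orP[] /eqP->; first by exists false.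
by exists true.
Qed.

(** * The equation with D = Y ^+ 2 - 1 *)

Section ChebyshevAt.

Variables (K : fieldType) (Y : {poly K}).

Definition chebT n : {poly K} := map_poly intr (chebyshevT n) \Po Y.
Definition chebUpred n : {poly K} := map_poly intr (chebyshevUpred n) \Po Y.

Lemma chebT0 : chebT 0 = 1.
Proof. by rewrite /chebT /= !rmorph1. Qed.

Lemma chebUpred0 : chebUpred 0 = 0.
Proof. by rewrite /chebUpred /= !rmorph0. Qed.

Lemma chebTS n : chebT n.+1 = Y * chebT n + (Y ^+ 2 - 1) * chebUpred n.
Proof.
rewrite /chebT /chebUpred (chebyshevS n).1 !(rmorphD, rmorphM, rmorphN, rmorphXn).
by rewrite !rmorph1 /= map_polyX comp_polyX.
Qed.

Lemma chebUpredS n : chebUpred n.+1 = chebT n + Y * chebUpred n.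
Proof.
rewrite /chebT /chebUpred (chebyshevS n).2 !(rmorphD, rmorphM).
by rewrite /= map_polyX comp_polyX.
Qed.

(** The norm is multiplicative and Y + sqrt (Y ^+ 2 - 1) has norm 1. *)
Lemma cheb_pell n : chebT n ^+ 2 - (Y ^+ 2 - 1) * chebUpred n ^+ 2 = 1.
Proof.
elim: n => [|n IHn]; first by rewrite chebT0 chebUpred0; ring.
by rewrite chebTS chebUpredS -{}[RHS]IHn; ring.
Qed.

Hypothesis K2 : 2 != 0 :> K.

Lemma size_chebT n : size Y = 2%N -> size (chebT n) = n.+1.
Proof.
move=> sY.
have Y0 : Y != 0 by rewrite -size_poly_gt0 sY.
suff [] : size (chebT n) = n.+1 /\ size (chebT n.+1) = n.+2 by [].
elim: n => [|n [IH0 IH1]].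
  by rewrite chebTS chebT0 chebUpred0 mulr1 mulr0 addr0 size_poly1.
split=> //.
(* The two-step recurrence is used because its second term has lower degree:
   the two terms of [chebTS] both have full degree. *)
have -> : chebT n.+2 = 2 *: (Y * chebT n.+1) - chebT n.
  by rewrite scaler_nat !(chebTS, chebUpredS); ring.
have T0 : chebT n.+1 != 0 by rewrite -size_poly_gt0 IH1.
have sYT : size (2 *: (Y * chebT n.+1)) = n.+3.
  by rewrite size_scale // size_mulf // sY IH1.
by rewrite size_polyDl // sYT size_polyN IH0.
Qed.

Lemma size_sqr_sub1 : (1 < size Y)%N -> size (Y ^+ 2 - 1) = (size Y + size Y).-1.
Proof.
move=> sY; have Y0 : Y != 0 by rewrite -size_poly_gt0; case: size sY.
have sY2 : size (Y ^+ 2) = (size Y + size Y).-1 by rewrite expr2 size_mulf.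
by rewrite size_polyDl sY2 // size_polyN size_poly1; lia.
Qed.

(** Comparing degrees in [P ^+ 2 = (Y ^+ 2 - 1) * Q ^+ 2 + 1], where the
    constant 1 is negligible: [deg P = deg Y + deg Q]. *)
Lemma pell_size (P Q : {poly K}) : (1 < size Y)%N -> Q != 0 ->
  P ^+ 2 - (Y ^+ 2 - 1) * Q ^+ 2 = 1 -> (size P).+1 = (size Y + size Q)%N.
Proof.
move=> sY Q0 eqPQ.
have sQ : (0 < size Q)%N by rewrite size_poly_gt0.
have sD := size_sqr_sub1 sY.
have D0 : Y ^+ 2 - 1 != 0.
  by rewrite -size_poly_gt0 sD; lia.
have E : P ^+ 2 = (Y ^+ 2 - 1) * Q ^+ 2 + 1.
  by rewrite -[X in _ = _ + X]eqPQ; ring.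
have sDQ : size ((Y ^+ 2 - 1) * Q ^+ 2) =
    (size Y + size Q + (size Y + size Q) - 3)%N.
  rewrite size_mulf ?expf_neq0 // sD expr2 size_mulf //; lia.
have sP2 : size (P ^+ 2) = (size Y + size Q + (size Y + size Q) - 3)%N.
  by rewrite E size_polyDl sDQ // size_poly1; lia.
have P0 : P != 0.
  by apply/eqP => P0; move: sP2; rewrite P0 expr0n size_poly0; lia.
by move: sP2; rewrite expr2 size_mulf //; lia.
Qed.

(** Since [(Y * Q - P) * (P + Y * Q) = Q ^+ 2 - 1] and the second factor has the
    degree of P, which exceeds that of Q, the first one has degree less than Q.
    It is the second component of the new solution, so [pell_size] turns this
    into a bound on the first component. *)
Lemma pell_descent (P Q : {poly K}) :
  (1 < size Y)%N -> Q != 0 -> P ^+ 2 - (Y ^+ 2 - 1) * Q ^+ 2 = 1 ->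
  size (P + Y * Q) = size P ->
  (size (Y * P - (Y ^+ 2 - 1) * Q)%R < size P)%N.
Proof.
move=> sY Q0 eqPQ sPYQ; have sP := pell_size sY Q0 eqPQ.
have sQ : (0 < size Q)%N by rewrite size_poly_gt0.
have eqPQ' : (Y * P - (Y ^+ 2 - 1) * Q) ^+ 2
    - (Y ^+ 2 - 1) * (Y * Q - P) ^+ 2 = 1 by rewrite -[RHS]eqPQ; ring.
(* If the new second component vanishes, the first is constant. *)
have [Q'0|Q'0] := eqVneq (Y * Q - P) 0.
  move: eqPQ'; rewrite Q'0 expr0n mulr0 subr0 => /sqr_eq1_sign[e ->].
  by rewrite -[_ ^+ e]mulr1 size_Msign size_poly1; lia.
have sP' := pell_size sY Q'0 eqPQ'.
have PYQ0 : P + Y * Q != 0 by rewrite -size_poly_gt0 sPYQ; lia.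
have E : (Y * Q - P) * (P + Y * Q) = Q ^+ 2 - 1.
  by rewrite -[X in _ = _ - X]eqPQ; ring.
have : (size (Q ^+ 2 - 1)%R <= (size Q + size Q).-1)%N.
  apply: size_addf_leq; first by rewrite expr2 size_mulf.
  by rewrite size_polyN size_poly1; lia.
rewrite -E size_mulf // sPYQ; move: Q'0; rewrite -size_poly_gt0; lia.
Qed.

(** P and Y * Q have the same degree, and the two sums add up to 2 P: the leading
    terms cannot cancel in both. *)
Lemma pell_descent_choice (P Q : {poly K}) :
  (1 < size Y)%N -> Q != 0 -> P ^+ 2 - (Y ^+ 2 - 1) * Q ^+ 2 = 1 ->
  size (P + Y * Q) = size P \/ size (P + Y * - Q) = size P.
Proof.
move=> sY Q0 eqPQ; have sP := pell_size sY Q0 eqPQ.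
have Y0 : Y != 0 by rewrite -size_poly_gt0; case: size sY.
have sYQ : size (Y * Q) = size P by rewrite size_mulf // -sP.
have le1 : (size (P + Y * Q)%R <= size P)%N.
  by rewrite size_addf_leq // sYQ.
have le2 : (size (P + Y * - Q)%R <= size P)%N.
  by rewrite size_addf_leq // mulrN size_polyN sYQ.
have : (size P <= maxn (size (P + Y * Q)%R) (size (P + Y * - Q)%R))%N.
  rewrite -(size_scale P K2).
  have -> : 2 *: P = (P + Y * Q) + (P + Y * - Q).
    by rewrite scaler_nat; ring.
  by apply: size_addf_leq; rewrite leq_max leqnn ?orbT.
lia.
Qed.

(** Multiplying by Y + sqrt (Y ^+ 2 - 1) preserves the set of powers of this unit,
    their conjugates and their opposites. The exponent goes up when the signs
    agree and down when they differ, since conjugation is inversion. *)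
Lemma cheb_signed_step (n : nat) (e f : bool) : exists m (e' f' : bool),
  Y * ((-1) ^+ e * chebT n) + (Y ^+ 2 - 1) * ((-1) ^+ f * chebUpred n)
    = (-1) ^+ e' * chebT m /\
  ((-1) ^+ e * chebT n) + Y * ((-1) ^+ f * chebUpred n) = (-1) ^+ f' * chebUpred m.
Proof.
have [->|nef] := eqVneq f e.
  by exists n.+1, e, e; rewrite chebTS chebUpredS; split; ring.
have -> : f = ~~ e by case: e f nef => [] [].
rewrite signrN; case: n => [|n].
  by exists 1, e, e; rewrite chebTS chebUpredS chebT0 chebUpred0; split; ring.
by exists n, e, (~~ e); rewrite !(chebTS, chebUpredS) signrN; split; ring.
Qed.

(** Strong induction on the degree of P, by descent. *)
Lemma pell_cheb (P Q : {poly K}) :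
  (1 < size Y)%N -> P ^+ 2 - (Y ^+ 2 - 1) * Q ^+ 2 = 1 ->
  exists n (e f : bool), P = (-1) ^+ e * chebT n /\ Q = (-1) ^+ f * chebUpred n.
Proof.
move=> sY; have [k lek] := ubnP (size P).
elim: k P Q lek => // k IHk P Q lek eqPQ.
have [Q0|Q0] := eqVneq Q 0.
  move: eqPQ; rewrite Q0 expr0n mulr0 subr0 => /sqr_eq1_sign[e ->].
  by exists 0, e, false; rewrite chebT0 chebUpred0 !(mulr1, mulr0).
wlog sPQ : Q eqPQ Q0 / size (P + Y * Q) = size P.
  move=> IH; have [|sPQ] := pell_descent_choice sY Q0 eqPQ; first exact: IH.
  have [||//|n [e [f [eqP eqQ]]]] := IH (- Q); rewrite ?sqrrN ?oppr_eq0 //.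
  by exists n, e, (~~ f); rewrite -[Q]opprK eqQ signrN mulNr.
have lt := pell_descent sY Q0 eqPQ sPQ.
have [||n [e [f [eqP' eqQ']]]] := IHk (Y * P - (Y ^+ 2 - 1) * Q) (Y * Q - P).
- exact: leq_trans lt lek.
- by rewrite -[RHS]eqPQ; ring.
have [m [e' [f' [E1 E2]]]] := cheb_signed_step n e f.
exists m, e', f'; rewrite -E1 -E2 -eqP' -eqQ'; split; ring.
Qed.

End ChebyshevAt.

(** * The quadratic coefficient D *)

(** [P - W * Q] and [P + W * Q] are units of K[X], hence constant, and so is
    their sum 2 P. *)
Lemma pell_square_const (K : fieldType) (P Q W : {poly K}) : 2 != 0 :> K ->
  P ^+ 2 - W ^+ 2 * Q ^+ 2 = 1 -> (size P <= 1)%N.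
Proof.
move=> K2 eqPQ.
have E : (P - W * Q) * (P + W * Q) = 1 by rewrite -[RHS]eqPQ; ring.
have : size ((P - W * Q) * (P + W * Q)) == 1%N by rewrite E size_poly1.
rewrite size_mul_eq1 => /andP[/eqP s1 /eqP s2].
rewrite -(size_scale P K2).
have -> : 2 *: P = (P - W * Q) + (P + W * Q) by rewrite scaler_nat; ring.
by rewrite size_addf_leq ?s1 ?s2.
Qed.

(** Completing the square, [D = a *: (('X + t) ^+ 2 - h)], where h vanishes
    exactly when D has a double root; otherwise h is scaled to 1 by its square
    root. *)
Lemma quadratic_square_or_affine (K : numClosedFieldType) (D : {poly K}) :
  size D = 3%N ->
  (exists W, D = W ^+ 2) \/
  exists lambda mu nu : K, [/\ lambda != 0, mu != 0 &
    D = mu ^- 2 *: ((lambda *: 'X + nu%:P) ^+ 2 - 1)].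
Proof.
move=> sD; set a := D`_2; set b := D`_1; set c := D`_0.
have a0 : a != 0.
  rewrite /a -[2%N]/(3%N.-1) -sD -/(lead_coef D) lead_coef_eq0.
  by rewrite -size_poly_gt0 sD.
have DE : D = a *: 'X ^+ 2 + b *: 'X + c%:P.
  apply/polyP => -[|[|[|i]]]; rewrite !coefE /= -?/a -?/b -?/c; try ring.
  by rewrite nth_default ?sD //; ring.
set t := b / (2 * a); set h := t ^+ 2 - c / a.
have DE2 : D = a *: (('X + t%:P) ^+ 2 - h%:P).
  rewrite DE /h -!mul_polyC.
  have -> : b%:P = (a * t + a * t)%:P.
    by congr _%:P; rewrite /t; field.
  have -> : c%:P = (a * (c / a))%:P by congr _%:P; field.
  by rewrite polyCB rmorphXn /= polyCD !(polyCM a); ring.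
have [h0|h0] := eqVneq h 0.
  left; exists (sqrtC a *: ('X + t%:P)).
  by rewrite DE2 h0 subr0 exprZn sqrtCK.
right; have s0 : sqrtC h != 0 by rewrite sqrtC_eq0.
have r0 : sqrtC (a * h) != 0 by rewrite sqrtC_eq0 mulf_neq0.
exists (sqrtC h)^-1, (sqrtC (a * h))^-1, ((sqrtC h)^-1 * t).
split; rewrite ?invr_eq0 //.
rewrite exprVn invrK sqrtCK DE2 (polyCM _ t) mul_polyC -scalerDr exprZn exprVn sqrtCK.
rewrite -scalerA; congr (_ *: _); rewrite scalerBr scalerA divff // scale1r.
by rewrite alg_polyC.
Qed.

Theorem theorem1 (R : realType) (P Q D : {poly R[i]}) (d : nat)
    (d_gt0 : (0 < d)%N)
    (degD : size D = 3%N) (degP : size P = d.+1) :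
  P ^+ 2 - D * Q ^+ 2 = 1 <->
  exists lambda mu nu : R[i],
    [/\ lambda != 0, mu != 0,
        P = comp_affine (chebyshevT d) lambda nu \/
        P = - comp_affine (chebyshevT d) lambda nu,
        Q = mu *: comp_affine (chebyshevU d.-1) lambda nu &
        D = mu ^- 2 *: ((lambda *: 'X + nu%:P) ^+ 2 - 1)].
Proof.
have K2 : 2 != 0 :> R[i] by rewrite pnatr_eq0.
split=> [eqPQ | [l [m [v [l0 m0 eqP -> ->]]]]]; last first.
  set Y := l *: 'X + v%:P in eqP *.
  have -> : P ^+ 2 = chebT Y d ^+ 2.
    by case: eqP => ->; rewrite ?sqrrN.
  rewrite -[RHS](cheb_pell Y d) exprZn -scalerAl -scalerAr scalerA.
  rewrite mulVf ?expf_neq0 // scale1r.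
  by case: (d) d_gt0.
have [[W DW]|[l [m [v [l0 m0 DE]]]]] := quadratic_square_or_affine degD.
  move: eqPQ; rewrite DW => /(pell_square_const K2).
  by rewrite degP ltnS leqNgt d_gt0.
set Y := l *: 'X + v%:P in DE.
have sY : size Y = 2%N.
  rewrite /Y size_polyDl size_scale ?size_polyX //.
  by rewrite (leq_ltn_trans (size_polyC_leq1 _)).
have [||n [e [f [PE QE]]]] := @pell_cheb _ Y K2 P (m^-1 *: Q).
- by rewrite sY.
- by rewrite -[RHS]eqPQ DE exprZn -scalerAr scalerAl exprVn.
have nd : n = d.
  by move: degP; rewrite PE size_Msign (size_chebT K2) // => -[].
rewrite {}nd in PE QE.
(* The sign of P is free in the conclusion; that of Q is absorbed in mu, which
   enters D only through its square. *)
exists l, ((-1) ^+ f * m), v; split=> //.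
- by rewrite mulf_neq0 // signr_eq0.
- by rewrite PE; case: (e); [right; rewrite mulN1r|left; rewrite mul1r].
- have -> : Q = m *: (m^-1 *: Q) by rewrite scalerA divff // scale1r.
  rewrite QE -scalerA -[in RHS]mul_polyC scalerAr rmorph_sign.
  by case: (d) d_gt0.
- by rewrite exprMn sqrr_sign mul1r.
Qed.
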